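(* Let $(X,r)$ be an indecomposable multipermutation solution. Then every endomorphism of $(X,r)$ is surjective. In particular, if $|X|<\infty$, then every endomorphism of $(X,r)$ is an automorphism.
   Context: A solution is a pair $(X,r)$ with $X$ a nonempty set (possibly infinite) and $r:X^2\to X^2$ a bijection, $r(x,y)=(\sigma_x(y),\tau_y(x))$, satisfying the braid equation $(r\times \mathrm{id})(\mathrm{id}\times r)(r\times \mathrm{id})=(\mathrm{id}\times r)(r\times \mathrm{id})(\mathrm{id}\times r)$ with all maps $\sigma_x,\tau_x:X\to X$ bijective. An endomorphism of $(X,r)$ is a map $f:X\to X$ with $(f\times f)r=r(f\times f)$; an automorphism is a bijective endomorphism. $(X,r)$ is indecomposable if the subgroup of $\mathrm{Perm}(X)$ generated by all $\sigma_x,\tau_x$ ($x\in X$) acts transitively on $X$. The retraction $\mathrm{Ret}(X,r)$ is the induced solution on $X/{\sim}$, where $x\sim y$ iff $\sigma_x=\sigma_y$ and $\tau_x=\tau_y$; $(X,r)$ is a multipermutation solution if some iterated retraction $\mathrm{Ret}^n(X,r)$ ($n\ge 0$) has size $1$. *)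

(* Defs.v *)
From mathcomp Require Import all_boot.
From mathcomp Require Import boolp classical_sets cardinality.

Set Implicit Arguments.
Unset Strict Implicit.
Unset Printing Implicit Defensive.

Local Open Scope quotient_scope.

(* The convention is r (x, y) = (sigma r x y, tau r y x). *)
Definition sigma (X : Type) (r : X * X -> X * X) (x y : X) : X := (r (x, y)).1.
Definition tau (X : Type) (r : X * X -> X * X) (y x : X) : X := (r (x, y)).2.

(* r x id and id x r, on X * X * X = (X * X) * X. *)
Definition r12 (X : Type) (r : X * X -> X * X) (t : X * X * X) : X * X * X :=
  let: (x, y, z) := t in (r (x, y), z).
Definition r23 (X : Type) (r : X * X -> X * X) (t : X * X * X) : X * X * X :=
  let: (x, y, z) := t in (x, (r (y, z)).1, (r (y, z)).2).

Definition braid_equation (X : Type) (r : X * X -> X * X) : Prop :=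
  r12 r \o r23 r \o r12 r =1 r23 r \o r12 r \o r23 r.

Record is_solution (X : Type) (r : X * X -> X * X) : Prop := IsSolution {
  sol_bij : bijective r;
  sol_braid : braid_equation r;
  sol_sigma : forall x, bijective (sigma r x);
  sol_tau : forall x, bijective (tau r x) }.

Record solution := Solution {
  sol_sort :> Type;
  sol_map : sol_sort * sol_sort -> sol_sort * sol_sort;
  sol_inhabited : inhabited sol_sort;
  sol_axioms : is_solution sol_map }.

Definition endomorphism (S : solution) (f : S -> S) : Prop :=
  let ff (p : S * S) := (f p.1, f p.2) in
  ff \o sol_map (s := S) =1 sol_map (s := S) \o ff.

Definition automorphism (S : solution) (f : S -> S) : Prop :=
  endomorphism f /\ bijective f.

(* The subgroup of Perm(X) generated by all sigma_x and tau_x, as a set of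
   self-maps of X. *)
Inductive perm_group (S : solution) : (S -> S) -> Prop :=
| perm_group_sigma x : perm_group (sigma (sol_map (s := S)) x)
| perm_group_tau x : perm_group (tau (sol_map (s := S)) x)
| perm_group_id : perm_group id
| perm_group_comp f g : perm_group f -> perm_group g -> perm_group (f \o g)
| perm_group_inv f g :
    perm_group f -> cancel f g -> cancel g f -> perm_group g.

Definition indecomposable (S : solution) : Prop :=
  forall x y : S, exists g : S -> S, perm_group g /\ g x = y.

Definition retr_rel (X : Type) (r : X * X -> X * X) (x y : X) : Prop :=
  sigma r x = sigma r y /\ tau r x = tau r y.

Section RetractionTheory.

Lemma retr_refl X r (x : X) : retr_rel r x x. Proof. by []. Qed.

Lemma retr_sym X r (x y : X) : retr_rel r x y -> retr_rel r y x.
Proof. by case. Qed.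

Lemma retr_trans X r (y x z : X) :
  retr_rel r x y -> retr_rel r y z -> retr_rel r x z.
Proof. by move=> [xy xy'] [yz yz']; split; [rewrite xy|rewrite xy']. Qed.

Lemma braidE X (r : X * X -> X * X) : braid_equation r <->
  [/\ forall x y z, sigma r (sigma r x y) (sigma r (tau r y x) z)
                    = sigma r x (sigma r y z),
      forall x y z, tau r (sigma r (tau r y x) z) (sigma r x y)
                    = sigma r (tau r (sigma r y z) x) (tau r z y)
    & forall x y z, tau r z (tau r y x)
                    = tau r (tau r z y) (tau r (sigma r y z) x)].
Proof.
have E3 (x y z : X) :
    ((r12 r \o r23 r \o r12 r) (x, y, z) =
      (sigma r (sigma r x y) (sigma r (tau r y x) z),
       tau r (sigma r (tau r y x) z) (sigma r x y), tau r z (tau r y x)))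
  * ((r23 r \o r12 r \o r23 r) (x, y, z) =
      (sigma r x (sigma r y z), sigma r (tau r (sigma r y z) x) (tau r z y),
       tau r (tau r z y) (tau r (sigma r y z) x))).
  split; unfold comp, r12, r23, sigma, tau.
    by case: (r (x, y)) => a b /=; case: (r (a, _)).
  by case: (r (y, z)) => a b /=; case: (r (x, a)).
split=> [E|[b1 b2 b3] [[x y] z]]; last by rewrite !E3 b1 b2 b3.
by split=> x y z; have := E (x, y, z); rewrite !E3 => -[].
Qed.

Definition flip X (r : X * X -> X * X) (p : X * X) : X * X :=
  let q := r (p.2, p.1) in (q.2, q.1).

Lemma flip_solution X (r : X * X -> X * X) :
  is_solution r -> is_solution (flip r).
Proof.
case=> rb /braidE[b1 b2 b3] sb tb; split=> //.
- case: rb => s rK sK; exists (flip s) => -[x y]; rewrite /flip /=.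
    by case E: (r (y, x)) => [u v] /=; rewrite -E rK.
  by case E: (s (y, x)) => [u v] /=; rewrite -E sK.
- by apply/braidE; split=> x y z; [exact/esym/b3|exact/esym/b2|exact/esym/b1].
Qed.

Lemma inv_solution X (r s : X * X -> X * X) :
  cancel r s -> cancel s r -> is_solution r -> is_solution s.
Proof.
move=> rK sK [rb rbr sb tb].
have k12 : cancel (r12 r) (r12 s) by move=> [[x y] z] /=; case E: (r _) => [a b] /=; rewrite -E rK.
have k12' : cancel (r12 s) (r12 r) by move=> [[x y] z] /=; case E: (s _) => [a b] /=; rewrite -E sK.
have k23 : cancel (r23 r) (r23 s) by move=> [[x y] z] /=; rewrite -surjective_pairing rK.
have k23' : cancel (r23 s) (r23 r) by move=> [[x y] z] /=; rewrite -surjective_pairing sK.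
split; first by exists r.
- move=> t; apply/esym.
  have := rbr ((r23 s \o r12 s \o r23 s) t).
  rewrite /comp !(k12', k23') => E.
  by rewrite -[in RHS]E !(k12, k23).
- move=> u.
  have rE x y : r (x, y) = (sigma r x y, tau r y x) by rewrite /sigma /tau; case: (r _).
  have [si siK Ksi] : exists2 si, (forall x, cancel (sigma r x) (si x)) &
     (forall x, cancel (si x) (sigma r x)).
    have /choice[si H] : forall x, exists g, cancel (sigma r x) g /\ cancel g (sigma r x).
      by move=> x; case: (sb x) => g; exists g.
    by exists si => x; case: (H x).
  exists (fun x => tau r (si x u) x) => z; rewrite /sigma /=.
    case E: (s (u, z)) => [x y] /=.
    have : r (x, y) = (u, z) by rewrite -E sK.
    by rewrite rE => -[<- <-]; rewrite siK.
  by have := rK (z, si z u); rewrite rE Ksi => ->.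
- move=> u.
  have rE x y : r (x, y) = (sigma r x y, tau r y x) by rewrite /sigma /tau; case: (r _).
  have [ti tiK Kti] : exists2 ti, (forall x, cancel (tau r x) (ti x)) &
     (forall x, cancel (ti x) (tau r x)).
    have /choice[ti H] : forall x, exists g, cancel (tau r x) g /\ cancel g (tau r x).
      by move=> x; case: (tb x) => g; exists g.
    by exists ti => x; case: (H x).
  exists (fun y => sigma r (ti y u) y) => z; rewrite /tau /=.
    case E: (s (z, u)) => [x y] /=.
    have : r (x, y) = (z, u) by rewrite -E sK.
    by rewrite rE => -[<- <-]; rewrite tiK.
  by have := rK (ti z u, z); rewrite rE Kti => ->.
Qed.

Lemma retr_sigma X (r : X * X -> X * X) (x y y' : X) : is_solution r ->
  retr_rel r y y' -> retr_rel r (sigma r x y) (sigma r x y').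
Proof.
case=> _ /braidE[b1 b2 b3] sb tb [es et]; split; apply/funext => z.
  have [g _ gK] := sb (tau r y x).
  rewrite -[z]gK b1 et b1.
  by rewrite es.
by apply: (bij_inj (tb (tau r y x))); rewrite -b3 et -b3.
Qed.

Lemma retr_tau X (r : X * X -> X * X) (x y y' : X) : is_solution r ->
  retr_rel r y y' -> retr_rel r (tau r x y) (tau r x y').
Proof.
move=> hr [es et].
have [] := @retr_sigma X (flip r) x y y' (flip_solution hr) (conj et es).
by split.
Qed.

Lemma retr_cong X (r : X * X -> X * X) (x x' y y' : X) : is_solution r ->
  retr_rel r x x' -> retr_rel r y y' ->
  retr_rel r (sigma r x y) (sigma r x' y') /\
  retr_rel r (tau r y x) (tau r y' x').
Proof.
move=> hr hx hy; split.
  by case: (hx) => -> _; exact: retr_sigma.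
by case: (hy) => _ ->; exact: retr_tau.
Qed.

Lemma retr_diag X (r : X * X -> X * X) (y : X) : is_solution r ->
  exists u, sigma r u y = u.
Proof.
case=> _ /braidE[b1 b2 b3] sb tb.
have [g _ gK] := tb y; set x := g y; have tx : tau r y x = y by exact: gK.
exists (sigma r x y); suff -> : sigma r (sigma r x y) = sigma r x by [].
apply/funext => z; have [h _ hK] := sb y; rewrite -[z]hK.
by rewrite -{2}tx b1 hK.
Qed.

Lemma retr_inv_sigma X (r s : X * X -> X * X) (u u' : X) :
  is_solution r -> cancel r s -> cancel s r ->
  retr_rel r u u' -> sigma s u = sigma s u'.
Proof.
move=> hr rK sK [es et].
have [_ /braidE[b1 b2 b3] sb tb] := hr.
have rE x y : r (x, y) = (sigma r x y, tau r y x).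
  by rewrite /sigma /tau; case: (r _).
have ssb := sol_sigma (inv_solution rK sK hr).
have sE x y : sigma s (sigma r x y) (tau r y x) = x.
  by rewrite /sigma -rE rK.
(* sigma s w t = x iff t = tau_(sigma_x^-1 w) x; sigma_w t is the derived
   rack operation, for which every sigma_a is an automorphism *)
have equiv a w x t : sigma s w t = x ->
    exists2 t', sigma s (sigma r a w) t' = sigma r a x &
      sigma r (sigma r a w) t' = sigma r a (sigma r w t).
  move=> E; have [z Ew] : exists z, w = sigma r x z.
    by have [g _ gK] := sb x; exists (g w); rewrite gK.
  have Et : t = tau r z x by apply: (bij_inj (ssb w)); rewrite E Ew sE.
  exists (tau r (sigma r (tau r x a) z) (sigma r a x)).
    by rewrite Ew -(b1 a x z) sE.
  by rewrite Et b2 Ew b1.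
apply/funext => t.
set x := sigma s u t.
have [a Ea] := retr_diag x hr.
have [t' Et'] : exists t', sigma s u' t' = x.
  by have [g _ gK] := ssb u'; exists (g x); rewrite gK.
suff -> : t = t' by rewrite Et'.
have [p Ep Hp] := equiv a u x t erefl.
have [p' Ep' Hp'] := equiv a u' x t' Et'.
have [esa _] := @retr_sigma X r a u u' hr (conj es et).
have Hpt : p = tau r u a.
  by apply: (bij_inj (ssb (sigma r a u))); rewrite Ep Ea sE.
have Hpt' : p' = tau r u' a.
  by apply: (bij_inj (ssb (sigma r a u'))); rewrite Ep' Ea sE.
apply: (bij_inj (sb u)); apply: (bij_inj (sb a)).
by rewrite -Hp es -Hp' esa Hpt Hpt' et.
Qed.

Lemma retr_inv X (r s : X * X -> X * X) (u u' : X) :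
  is_solution r -> cancel r s -> cancel s r ->
  retr_rel r u u' -> retr_rel s u u'.
Proof.
move=> hr rK sK h; split; first exact: retr_inv_sigma h.
case: h => es et.
apply: (@retr_inv_sigma X (flip r) (flip s)) (flip_solution hr) _ _ (conj et es).
- move=> [x y]; rewrite /flip /=.
  by case E: (r (y, x)) => [a b] /=; rewrite -E rK.
- move=> [x y]; rewrite /flip /=.
  by case E: (s (y, x)) => [a b] /=; rewrite -E sK.
Qed.

Lemma retr_sigma_inj X (r : X * X -> X * X) (x y y' : X) : is_solution r ->
  retr_rel r (sigma r x y) (sigma r x y') -> retr_rel r y y'.
Proof.
move=> hr h; have [[s rK sK] _ _ _] := hr.
have hs := inv_solution rK sK hr.
have rE a b : r (a, b) = (sigma r a b, tau r b a).
  by rewrite /sigma /tau; case: (r _).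
have sE b : s (sigma r x b, tau r b x) = (x, b) by rewrite -rE rK.
have hi := retr_inv hr rK sK h.
have ev : tau r y x = tau r y' x.
  apply: (bij_inj (sol_sigma hs (sigma r x y))).
  by rewrite {2}hi.1 /sigma -!rE !rK.
apply: (retr_inv hs sK rK).
have := @retr_tau X s (tau r y x) _ _ hs hi.
by rewrite {2}ev /tau -!rE !rK.
Qed.

Lemma retr_tau_inj X (r : X * X -> X * X) (x y y' : X) : is_solution r ->
  retr_rel r (tau r x y) (tau r x y') -> retr_rel r y y'.
Proof.
move=> hr [es et].
by have [] := @retr_sigma_inj X (flip r) x y y' (flip_solution hr) (conj et es).
Qed.

End RetractionTheory.

Definition retr_bool (X : Type) (r : X * X -> X * X) : rel {classic X} :=
  fun x y => `[< retr_rel r x y >].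

Lemma retr_bool_equiv (X : Type) (r : X * X -> X * X) :
  equiv_class_of (retr_bool r).
Proof.
split=> [x|x y|y x z]; first exact/asboolP/retr_refl.
  by apply/asboolP/asboolP; exact: retr_sym.
by move=> /asboolP xy /asboolP yz; apply/asboolP/(retr_trans xy yz).
Qed.

Canonical retr_equiv (X : Type) (r : X * X -> X * X) :=
  EquivRelPack (retr_bool_equiv r).

Definition ret_sort (X : Type) (r : X * X -> X * X) : Type :=
  {eq_quot (retr_equiv r)}.

Definition ret_pi (X : Type) (r : X * X -> X * X) (x : X) : ret_sort r :=
  \pi_{eq_quot (retr_equiv r)} (x : {classic X}).

Definition ret_repr (X : Type) (r : X * X -> X * X) (c : ret_sort r) : X :=
  repr (c : {eq_quot (retr_equiv r)}).

(* Independent of the choice of representatives, by ret_mapE. *)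
Definition ret_map (X : Type) (r : X * X -> X * X)
    (p : ret_sort r * ret_sort r) : ret_sort r * ret_sort r :=
  let q := r (ret_repr p.1, ret_repr p.2) in (ret_pi r q.1, ret_pi r q.2).

Lemma ret_piP (X : Type) (r : X * X -> X * X) (x y : X) :
  ret_pi r x = ret_pi r y <-> retr_rel r x y.
Proof.
split=> [/eqP|h]; first by rewrite eqquotE => /asboolP.
by apply/eqP; rewrite eqquotE; exact/asboolP.
Qed.

Lemma ret_reprK (X : Type) (r : X * X -> X * X) (c : ret_sort r) :
  ret_pi r (ret_repr c) = c.
Proof. exact: reprK. Qed.

Lemma ret_repr_pi (X : Type) (r : X * X -> X * X) (x : X) :
  retr_rel r (ret_repr (ret_pi r x)) x.
Proof. by apply/ret_piP; exact: ret_reprK. Qed.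

Lemma ret_mapE (X : Type) (r : X * X -> X * X) (x y : X) : is_solution r ->
  ret_map (ret_pi r x, ret_pi r y)
  = (ret_pi r (sigma r x y), ret_pi r (tau r y x)).
Proof.
move=> hr; rewrite /ret_map /=.
have [h1 h2] := retr_cong hr (ret_repr_pi r x) (ret_repr_pi r y).
by congr pair; apply/ret_piP.
Qed.

Lemma ret_sigmaE (X : Type) (r : X * X -> X * X) (x y : X) : is_solution r ->
  sigma (@ret_map X r) (ret_pi r x) (ret_pi r y) = ret_pi r (sigma r x y).
Proof. by move=> hr; rewrite {1}/sigma ret_mapE. Qed.

Lemma ret_tauE (X : Type) (r : X * X -> X * X) (x y : X) : is_solution r ->
  tau (@ret_map X r) (ret_pi r y) (ret_pi r x) = ret_pi r (tau r y x).
Proof. by move=> hr; rewrite {1}/tau ret_mapE. Qed.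

Lemma ret_is_solution (X : Type) (r : X * X -> X * X) :
  is_solution r -> is_solution (@ret_map X r).
Proof.
move=> hr; have [[s rK sK] /braidE[b1 b2 b3] sb tb] := hr.
have hs := inv_solution rK sK hr.
have rE a b : r (a, b) = (sigma r a b, tau r b a).
  by rewrite /sigma /tau; case: (r _).
have sE a b : s (a, b) = (sigma s a b, tau s b a).
  by rewrite /sigma /tau; case: (s _).
have toS x y : retr_rel r x y -> retr_rel s x y by exact: retr_inv.
have ofS x y : retr_rel s x y -> retr_rel r x y by exact: retr_inv.
pose s' (p : ret_sort r * ret_sort r) :=
  let q := s (ret_repr p.1, ret_repr p.2) in (ret_pi r q.1, ret_pi r q.2).
have s'E x y :
    s' (ret_pi r x, ret_pi r y) = (ret_pi r (s (x, y)).1, ret_pi r (s (x, y)).2).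
  rewrite /s' /=.
  have [h1 h2] := retr_cong hs (toS _ _ (ret_repr_pi r x))
    (toS _ _ (ret_repr_pi r y)).
  by congr pair; apply/ret_piP/ofS.
split.
- exists s' => -[c d]; rewrite -(ret_reprK c) -(ret_reprK d).
    by rewrite ret_mapE // s'E -rE rK.
  rewrite s'E ret_mapE //; congr pair; congr ret_pi;
  by rewrite ?/sigma ?/tau -surjective_pairing sK.
- apply/braidE; split=> c d e;
    rewrite -(ret_reprK c) -(ret_reprK d) -(ret_reprK e);
    rewrite !(ret_tauE, ret_sigmaE) //.
  + by rewrite b1.
  + by rewrite b2.
  + by rewrite b3.
- move=> c; rewrite -(ret_reprK c); move: (ret_repr c) => x.
  have [g gK Kg] := sb x.
  exists (fun d => ret_pi r (g (ret_repr d))) => d; rewrite -(ret_reprK d).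
    rewrite ret_sigmaE //; apply/ret_piP/(@retr_sigma_inj X r x) => //.
    by rewrite Kg; exact: ret_repr_pi.
  by rewrite ret_sigmaE // Kg ret_reprK.
- move=> c; rewrite -(ret_reprK c); move: (ret_repr c) => x.
  have [g gK Kg] := tb x.
  exists (fun d => ret_pi r (g (ret_repr d))) => d; rewrite -(ret_reprK d).
    rewrite ret_tauE //; apply/ret_piP/(@retr_tau_inj X r x) => //.
    by rewrite Kg; exact: ret_repr_pi.
  by rewrite ret_tauE // Kg ret_reprK.
Qed.

Lemma ret_inhabited (X : Type) (r : X * X -> X * X) :
  inhabited X -> inhabited (ret_sort r).
Proof. by case=> x; exists; exact: ret_pi r x. Qed.

Definition Ret (S : solution) : solution :=
  Solution (ret_inhabited _ (sol_inhabited S))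
           (ret_is_solution (sol_axioms S)).

Definition multipermutation (S : solution) : Prop :=
  exists n, exists x : iter n Ret S, forall y : iter n Ret S, y = x.

(* Main.v *)
Require Import Defs.
From mathcomp Require Import all_boot.
From mathcomp Require Import boolp classical_sets cardinality.

(** The image [Y] of an endomorphism is nonempty and satisfies
    [sigma_y(Y) = Y = tau_y(Y)] for every [y] in [Y].  Any such [Y] is
    everything, by induction on the multipermutation level: the image of [Y]
    in the retraction has the same property, so every class contains an element
    of [Y].  Hence every [sigma_x] and [tau_x] is some [sigma_y], [tau_y] with
    [y] in [Y], so [Y] is invariant under the whole permutation group, which
    is transitive. *)

(** As the maps are bijective, the equivalence says that each carries [Q] onto [Q]; on an infinite
    set, inclusion alone would be weaker. *)
Definition stable_under (S : solution) (P Q : S -> Prop) : Prop :=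
  forall x y, P x ->
    (Q (sigma (sol_map (s := S)) x y) <-> Q y) /\
    (Q (tau (sol_map (s := S)) x y) <-> Q y).

(* Unlike transitivity of the group, this form of indecomposability passes to
   the retraction by pulling [Q] back, with no need to lift permutations. *)
Definition no_proper_stable (S : solution) : Prop :=
  forall Q : S -> Prop, stable_under S (fun=> True) Q ->
    forall x y, Q x -> Q y.

Lemma indecomposable_no_proper_stable (S : solution) :
  indecomposable S -> no_proper_stable S.
Proof.
move=> iS Q stQ x y Qx; have [g [Gg <-]] := iS x y.
(* An equivalence, unlike a one-way implication, passes to inverses. *)
suff /(_ x)[_] : forall z, Q (g z) <-> Q z by apply.
elim: Gg => {g} [a z|a z|z|g h _ IHg _ IHh z|g h _ IHg gK hK z] //=.
- exact: (stQ a z I).1.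
- exact: (stQ a z I).2.
- exact: iff_trans (IHg _) (IHh _).
- by rewrite -{2}(hK z) IHg.
Qed.

Lemma no_proper_stable_Ret (S : solution) :
  no_proper_stable S -> no_proper_stable (Ret S).
Proof.
move=> nS Q stQ c d.
rewrite -(ret_reprK c) -(ret_reprK d).
apply: (nS (fun x => Q (ret_pi _ x))) => x y _.
have solS := sol_axioms S.
have := stQ (ret_pi _ x) (ret_pi _ y) I.
by rewrite ret_sigmaE // ret_tauE.
Qed.

Lemma stable_under_self_full (S : solution) (Y : S -> Prop) :
  no_proper_stable S -> multipermutation S ->
  stable_under S Y Y -> (exists y, Y y) -> forall x, Y x.
Proof.
move=> nS [n mS]; elim: n S Y nS mS => [|n IHn] S Y nS mS stY [y Yy].
  by case: mS => /= z eqz x; rewrite (eqz x) -(eqz y).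
have solS := sol_axioms S.
move: mS; rewrite iterSr => mS.
pose Z (c : Ret S) := exists2 z, Y z & ret_pi _ z = c.
have ZP : forall c, Z c.
  apply: IHn mS _ _; first exact: no_proper_stable_Ret.
    move=> c d [a Ya <-]; rewrite -(ret_reprK d).
    rewrite ret_sigmaE // ret_tauE //.
    set b := ret_repr _; split; split.
    (* Cancelling sigma_a on classes requires its inverse to respect the retraction relation: this
       is [retr_sigma_inj]. *)
    - move=> [z Yz /ret_piP ez].
      have [g gK Kg] := sol_sigma solS a.
      exists (g z); first by apply/(stY a (g z) Ya).1; rewrite Kg.
      by apply/ret_piP/(retr_sigma_inj (x := a) solS); rewrite Kg.
    - move=> [z Yz /ret_piP ez].
      exists (sigma (sol_map (s := S)) a z); first exact/(stY a z Ya).1.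
      exact/ret_piP/retr_sigma.
    - move=> [z Yz /ret_piP ez].
      have [g gK Kg] := sol_tau solS a.
      exists (g z); first by apply/(stY a (g z) Ya).2; rewrite Kg.
      by apply/ret_piP/(retr_tau_inj (x := a) solS); rewrite Kg.
    - move=> [z Yz /ret_piP ez].
      exists (tau (sol_map (s := S)) a z); first exact/(stY a z Ya).2.
      exact/ret_piP/retr_tau.
  by exists (ret_pi _ y), y.
move=> x; apply: nS Yy => a b _.
have [a' Ya' /ret_piP[<- <-]] := ZP (ret_pi _ a).
exact: stY.
Qed.

Lemma endomorphism_image_stable (S : solution) (f : S -> S) :
  endomorphism f ->
  stable_under S (fun y => exists x, f x = y) (fun y => exists x, f x = y).
Proof.
move=> fE _ y [a <-]; have solS := sol_axioms S.
have fs u v : f (sigma (sol_map (s := S)) u v)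
    = sigma (sol_map (s := S)) (f u) (f v).
  by have /(congr1 fst) := fE (u, v).
have ft u v : f (tau (sol_map (s := S)) u v)
    = tau (sol_map (s := S)) (f u) (f v).
  by have /(congr1 snd) := fE (v, u).
split; split.
(* sigma_(f a) sends both [y] and [f (g x)] to [f x], so they coincide. *)
- move=> [x ex]; have [g gK Kg] := sol_sigma solS a; exists (g x).
  by apply: (bij_inj (sol_sigma solS (f a))); rewrite -fs Kg.
- by move=> [x <-]; exists (sigma (sol_map (s := S)) a x).
- move=> [x ex]; have [g gK Kg] := sol_tau solS a; exists (g x).
  by apply: (bij_inj (sol_tau solS (f a))); rewrite -ft Kg.
- by move=> [x <-]; exists (tau (sol_map (s := S)) a x).
Qed.

(** A right inverse [g] of [f] is injective, hence onto by counting; writing [x] as [g y] gives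
    [g (f x) = x]. *)
Lemma finite_surjective_bijective (T : Type) (f : T -> T) :
  finite_set [set: T]%classic -> (forall y, exists x, f x = y) -> bijective f.
Proof.
move=> finT /choice[g gK]; exists g => // x.
have [s sE] := (@finite_seqP {classic T} _).1 finT.
have sT (z : {classic T}) : z \in undup s.
  by rewrite mem_undup; suff : [set` s]%classic z by []; rewrite -sE.
have ginj : injective (g : {classic T} -> {classic T}) by exact: can_inj gK.
have [_ /(_ (x : {classic T}))] :=
  uniq_min_size (s1 := map (g : {classic T} -> {classic T}) (undup s))
    (s2 := undup s) ltac:(by rewrite map_inj_uniq ?undup_uniq)
    (fun z _ => sT z) ltac:(by rewrite size_map).
by rewrite sT => /mapP[y _ ->]; rewrite gK.
Qed.

Theorem corollary5p2 (S : solution) :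
  indecomposable S -> multipermutation S ->
  (forall f : S -> S, endomorphism f -> forall y : S, exists x : S, f x = y) /\
  (finite_set [set: S]%classic ->
   forall f : S -> S, endomorphism f -> automorphism f).
Proof.
move=> iS mS.
have surjf (f : S -> S) : endomorphism f -> forall y, exists x, f x = y.
  move=> fE; apply: (stable_under_self_full _ _ _ mS (endomorphism_image_stable _ _ fE)).
    exact: indecomposable_no_proper_stable.
  by case: (sol_inhabited S) => x; exists (f x), x.
split=> // finS f fE; split=> //.
exact: (finite_surjective_bijective _ _ finS (surjf f fE)).
Qed.
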